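(* Let $G=(V,E,w)$ be a finite weighted directed graph and, for $q>0$, let $\Phi_q$ be the random rooted spanning forest of $G$ of intensity $q$, with $r_q:=r(\Phi_q)$ its number of roots. Let $\mathcal{F}$ be the set of rooted spanning forests of $G$. Then for any subset $\mathcal{H}\subseteq\mathcal{F}$ and any $q>0$, $$\frac{d}{dq}\mathbb{P}(\Phi_q\in\mathcal{H})=\frac1q\,\mathbb{P}(\Phi_q\in\mathcal{H})\Big[\mathbb{E}[r_q\mid\Phi_q\in\mathcal{H}]-\mathbb{E}[r_q]\Big].$$
   Context: A weighted directed graph $G=(V,E,w)$ has a finite vertex set $V$, a set $E\subseteq\{(x,y):x,y\in V\}$ of directed edges and a weight function $w:E\to[0,\infty)$. A rooted spanning forest of $G$ is a subset $F\subseteq E$ such that each vertex has at most one outgoing edge in $F$ and $F$ contains no directed cycle. The roots of $F$ are the vertices without outgoing edge in $F$; $r(F)$ is the number of roots. For $q>0$, $\Phi_q$ is the $\mathcal{F}$-valued random variable with law $\mathbb{P}(\Phi_q=F)=q^{r(F)}w(F)/Z(q)$, where $w(F)=\prod_{e\in F}w(e)$ and $Z(q)=\sum_{F\in\mathcal{F}}q^{r(F)}w(F)$. If $\mathbb{P}(\Phi_q\in\mathcal{H})=0$, the right-hand side is interpreted as $0$. *)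

(* Defs.v *)
From HB Require Import structures.
From mathcomp Require Import all_boot all_order all_algebra.
From mathcomp Require Import all_classical all_reals all_analysis.

Set Implicit Arguments.
Unset Strict Implicit.
Unset Printing Implicit Defensive.

Import Order.TTheory GRing.Theory Num.Theory.
Import numFieldNormedType.Exports.

Local Open Scope ring_scope.

(* The weight is a total function on pairs of vertices, but only its values on
   [edges] are constrained or used. Self-loops are allowed. *)
Record wdigraph (R : realType) := WDigraph {
  vertex :> finType;
  edges : {set vertex * vertex};
  weight : vertex * vertex -> R;
  weight_ge0 : forall e, e \in edges -> 0 <= weight e }.

Section Forests.
Context {R : realType} (G : wdigraph R).
Implicit Types (F : {set G * G}) (q : R).

Definition adj F : rel G := [rel x y | (x, y) \in F].

(* [ucycle] is a cycle with pairwise distinct vertices; the cyclic sequence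
   [:: x] stands for a self-loop at x, and [::] is always a cycle. *)
Definition acyclic F : Prop := forall c : seq G, ucycle (adj F) c -> c = [::].

Definition is_forest F : Prop :=
  [/\ F \subset edges G,
      forall x : G, (#|[set y | adj F x y]| <= 1)%N
    & acyclic F].

Definition forests : {set {set G * G}} := finset (fun F => `[< is_forest F >]).

Definition roots F : {set G} := finset (fun x => [forall y, ~~ adj F x y]).

Definition nroots F : nat := #|roots F|.

Definition forest_weight F : R := \prod_(e in F) weight e.

Definition partition_function q : R :=
  \sum_(F in forests) q ^+ nroots F * forest_weight F.

Definition forest_law q F : R :=
  q ^+ nroots F * forest_weight F / partition_function q.

(* [Phi] is a random rooted spanning forest of intensity [q] on the probability
   space [(T, P)]; since {set G * G} is finite, it is measurable as soon as the
   preimages of singletons are. *)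
Definition random_forest q d (T : measurableType d) (P : probability T R)
    (Phi : T -> {set G * G}) : Prop :=
  [/\ forall t, Phi t \in forests,
      forall F, measurable (Phi @^-1` [set F])%classic
    & forall F, F \in forests ->
        P (Phi @^-1` [set F])%classic = (forest_law q F)%:E].

End Forests.

Section Conditioning.
Context {R : realType} d (T : measurableType d) (P : probability T R).

Definition prob (A : set T) : R := fine (P A).

Definition expect (X : T -> R) : R := fine ('E_P[X])%E.

(* E[X | A] for an event A; by the convention x / 0 = 0 it is 0 if P(A) = 0. *)
Definition cond_expect (X : T -> R) (A : set T) : R :=
  expect (fun t => X t * \1_A t) / prob A.

End Conditioning.

(* Main.v *)
Require Import Defs.
From HB Require Import structures.
From mathcomp Require Import all_boot all_order all_algebra.
From mathcomp Require Import all_classical all_reals all_analysis.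
From mathcomp Require Import ring.
Set Implicit Arguments.
Unset Strict Implicit.
Unset Printing Implicit Defensive.
Import Order.TTheory GRing.Theory Num.Theory.
Import numFieldNormedType.Exports.
Local Open Scope ring_scope.

(** The law of [Phi q] is an exponential family in log q with sufficient
    statistic [nroots]. For a set [A] of forests let [roots_gf A] be the
    polynomial in q whose coefficient of q^n is the total weight of the
    forests of [A] with n roots; write N and Z for the polynomials of [H] and
    of [forests G]. The probability of the event is N(q) / Z(q), so the
    quotient rule applies. Because q * d/dq multiplies q^n by n, the operator
    turns a total mass into a sum of root counts: E[r] = q Z'(q) / Z(q)
    and E[r 1_H] = q N'(q) / Z(q) ([roots_gf_deriv], [expect_random_forest]).
    Substituting these, the right-hand side of the claim becomes
    (N'(q) Z(q) - N(q) Z'(q)) / Z(q)^2.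

    Two points need care. First, Z(q) must not vanish: the empty forest alone
    contributes q^|V| > 0 ([partition_function_gt0]). Secondly, if the event
    is null, then N(q) = 0, and as its terms are nonnegative each of them is
    zero; hence N'(q) = 0 too, and both sides vanish
    ([roots_gf_deriv_null]). *)

Section FiniteRange.
Context {R : realType} d (T : measurableType d) (P : probability T R).
Variables (I : finType) (X : T -> I).
Hypothesis mX : forall i, measurable (X @^-1` [set i])%classic.

(** The function is a finite linear combination of indicators of the fibres of
    [X], each of which is integrable because a probability is finite. *)
Lemma expect_finite_range (f : I -> R) :
  expect P (fun t => f (X t)) = \sum_i f i * prob P (X @^-1` [set i])%classic.
Proof.
pose fibre i := (X @^-1` [set i])%classic.
have fXE t : (f (X t))%:E = (\sum_i (f i)%:E * (\1_(fibre i) t)%:E)%E.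
  rewrite (bigD1 (X t)) //= big1 ?adde0 => [|i iX].
    by rewrite indicE mem_set// mule1.
  by rewrite indicE memNset ?mule0 // => Xi; rewrite -Xi eqxx in iX.
rewrite /expect unlock (eq_integral _ _ (fun t _ => fXE t)).
have mfibre i : measurable (fibre i) by exact: mX.
have int1 i : P.-integrable setT (fun t => (\1_(fibre i) t)%:E).
  exact: integrable_indic.
rewrite integral_sum // => [|i]; last exact: integrableZl.
rewrite (eq_bigr (fun i => (f i * prob P (fibre i))%:E)) => [|i _].
  by rewrite sumEFin.
by rewrite integralZl // integral_indic // setIT EFinM fineK ?fin_num_measure.
Qed.

Lemma measurable_finite_range (A : {set I}) :
  measurable [set t | X t \in A]%classic.
Proof.
rewrite (_ : mkset _ = \bigcup_(i in [set` A]) (X @^-1` [set i]))%classic.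
  by apply: fin_bigcup_measurable.
by apply/seteqP; split=> t /= => [XA|[i iA ->//]]; exists (X t).
Qed.

Lemma prob_finite_range (A : {set I}) :
  prob P [set t | X t \in A]%classic = expect P (fun t => (X t \in A)%:R).
Proof.
rewrite /prob -expectation_indic; last exact: measurable_finite_range.
congr (fine (expectation P _)); apply/funext => t.
rewrite indicE; congr (nat_of_bool _)%:R.
by apply/idP/idP; rewrite in_setE.
Qed.

End FiniteRange.

Section RootsGF.
Context {R : realType} (G : wdigraph R).
Implicit Types (A H : {set {set G * G}}) (F : {set G * G}) (q : R).

Lemma forest_weight_ge0 F : F \in forests G -> 0 <= forest_weight F.
Proof.
rewrite inE => /asboolP[FE _ _]; apply: prodr_ge0 => e eF.
by apply: weight_ge0; exact: (fintype.subsetP FE).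
Qed.

Lemma forests0 : finset.set0 \in forests G.
Proof.
rewrite inE; apply/asboolP; split; first exact: finset.sub0set.
  by move=> x; rewrite eq_card0 // => y; rewrite !inE /adj /= inE.
by case=> // x [|y c] /andP[/andP[]]; rewrite /adj /= inE.
Qed.

Lemma partition_function_gt0 q : 0 < q -> 0 < partition_function G q.
Proof.
move=> q0; rewrite /partition_function (bigD1 finset.set0) ?forests0 //=.
apply: ltr_pwDl; first by rewrite /forest_weight big_set0 mulr1 exprn_gt0.
by apply: sumr_ge0 => F /andP[/forest_weight_ge0 w0 _];
  rewrite mulr_ge0 // exprn_ge0 // ltW.
Qed.

Definition roots_gf A : {poly R} :=
  \sum_(F in A) forest_weight F *: 'X^(nroots F).

Lemma horner_roots_gf A q :
  (roots_gf A).[q] = \sum_(F in A) q ^+ nroots F * forest_weight F.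
Proof.
by rewrite horner_sum; apply: eq_bigr => F _; rewrite !hornerE mulrC.
Qed.

(** The Euler operator q * d/dq weights each forest by its number of roots. *)
Lemma roots_gf_deriv A q :
  q * (roots_gf A)^`().[q] =
  \sum_(F in A) (nroots F)%:R * (q ^+ nroots F * forest_weight F).
Proof.
rewrite raddf_sum horner_sum mulr_sumr; apply: eq_bigr => F _.
rewrite /= derivZ derivXn hornerZ hornerMn hornerXn.
case: (nroots F) => [|n]; first by rewrite mulr0n mulr0 mulr0 mul0r.
by rewrite /= exprS -mulr_natl; ring.
Qed.

(** A sum of nonnegative terms vanishes only termwise, so a null set of forests
    carries no root mass either. *)
Lemma roots_gf_deriv_null A q : A \subset forests G -> 0 < q ->
  (roots_gf A).[q] = 0 -> (roots_gf A)^`().[q] = 0.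
Proof.
move=> sAF q0 N0; apply: (mulfI (lt0r_neq0 q0)); rewrite mulr0 roots_gf_deriv.
move/eqP: N0; rewrite horner_roots_gf psumr_eq0 => [/allP N0|F FA]; last first.
  have wF := forest_weight_ge0 (fintype.subsetP sAF F FA).
  by rewrite mulr_ge0 // exprn_ge0 // ltW.
apply: big1 => F FA; have := N0 F (mem_index_enum F).
by rewrite FA => /eqP ->; rewrite mulr0.
Qed.

(** Stated for the unnormalised masses, so that every expectation appears as a
    quotient with denominator the partition function. *)
Lemma expect_random_forest q d (T : measurableType d) (P : probability T R)
    (Phi : T -> {set G * G}) (f : {set G * G} -> R) :
  random_forest q P Phi ->
  expect P (fun t => f (Phi t)) =
  (\sum_(F in forests G) f F * (q ^+ nroots F * forest_weight F)) /
    partition_function G q.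
Proof.
case=> PhiF mPhi lawPhi; rewrite expect_finite_range // mulr_suml.
rewrite [RHS]big_mkcond; apply: eq_bigr => F _.
case: ifPn => FF; first by rewrite /prob lawPhi //= /forest_law mulrA.
rewrite (_ : preimage _ _ = set0) ?/prob ?measure0 ?mulr0 //.
by apply/seteqP; split=> t //= PhitF; rewrite -PhitF PhiF in FF.
Qed.

Lemma expect_random_forest_on q d (T : measurableType d) (P : probability T R)
    (Phi : T -> {set G * G}) (f : {set G * G} -> R) H :
  random_forest q P Phi -> H \subset forests G ->
  expect P (fun t => f (Phi t) * (Phi t \in H)%:R) =
  (\sum_(F in H) f F * (q ^+ nroots F * forest_weight F)) /
    partition_function G q.
Proof.
move=> PhiP sHF.
rewrite (expect_random_forest (fun F => f F * (F \in H)%:R) PhiP).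
congr (_ / _); rewrite big_mkcond [RHS]big_mkcond; apply: eq_bigr => F _ /=.
have [FH|FH] := boolP (F \in H).
  by rewrite (fintype.subsetP sHF) // mulr1.
by rewrite mulr0 mul0r if_same.
Qed.

Lemma prob_random_forest q d (T : measurableType d) (P : probability T R)
    (Phi : T -> {set G * G}) H :
  random_forest q P Phi -> H \subset forests G ->
  prob P [set t | Phi t \in H]%classic =
  (roots_gf H).[q] / (roots_gf (forests G)).[q].
Proof.
move=> PhiP sHF; have [_ mPhi _] := PhiP; rewrite prob_finite_range //.
have := expect_random_forest_on (fun=> 1) PhiP sHF.
under eq_fun do rewrite mul1r.
under eq_bigr do rewrite mul1r.
by rewrite !horner_roots_gf.
Qed.

End RootsGF.

Lemma is_derive_horner_div (R : realType) (p z : {poly R}) (q : R) :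
  z.[q] != 0 ->
  is_derive q 1 (fun s => p.[s] / z.[s])
    ((p^`().[q] * z.[q] - p.[q] * z^`().[q]) / z.[q] ^+ 2).
Proof.
move=> z0; have dV := is_deriveV z0 (is_derive_poly z q).
apply: is_derive_eq (is_deriveM (is_derive_poly p q) dV) _.
by rewrite /GRing.scale /=; field.
Qed.

Theorem theorem1 (R : realType) (G : wdigraph R)
    (d : R -> measure_display) (T : forall q : R, measurableType (d q))
    (P : forall q : R, probability (T q) R)
    (Phi : forall q : R, T q -> {set G * G})
    (Phi_forest : forall q : R, 0 < q -> random_forest q (P q) (Phi q))
    (H : {set {set G * G}}) (sHF : H \subset forests G)
    (q : R) (q_gt0 : 0 < q) :
  let event (s : R) : set (T s) := [set t | Phi s t \in H]%classic in
  let r (t : T q) : R := (nroots (Phi q t))%:R in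
  is_derive q 1 (fun s : R => prob (P s) (event s))
    (q^-1 * prob (P q) (event q) *
       (cond_expect (P q) r (event q) - expect (P q) r)).
Proof.
move=> event r; have PhiP := Phi_forest q q_gt0.
pose N := roots_gf H; pose Z := roots_gf (forests G).
have ZE : partition_function G q = Z.[q] by rewrite horner_roots_gf.
have Z_neq0 : Z.[q] != 0 by rewrite -ZE gt_eqF ?partition_function_gt0.
have q_neq0 : q != 0 by rewrite gt_eqF.
have Er : expect (P q) r = q * Z^`().[q] / Z.[q].
  rewrite -ZE roots_gf_deriv.
  exact: (expect_random_forest (fun F => (nroots F)%:R) PhiP).
have ErH : expect (P q) (fun t => r t * \1_(event q) t) =
    q * N^`().[q] / Z.[q].
  rewrite -ZE roots_gf_deriv.
  rewrite -(expect_random_forest_on (fun F => (nroots F)%:R) PhiP sHF).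
  congr (expect _ _); apply/funext => t; rewrite indicE.
  by congr (_ * (nat_of_bool _)%:R); apply/idP/idP; rewrite in_setE.
(* The law is only prescribed at positive intensities, which form a
   neighbourhood of q. *)
apply: (@near_eq_is_derive _ _ _ (fun s => N.[s] / Z.[s])).
  near=> s; rewrite /event (prob_random_forest (Phi_forest s _)) //.
  by near: s; exact: lt_nbhsr.
apply: is_derive_eq (is_derive_horner_div N Z_neq0) _.
rewrite /cond_expect ErH Er (prob_random_forest PhiP) // -/N -/Z.
have [N0|N_neq0] := eqVneq N.[q] 0.
  by rewrite (roots_gf_deriv_null sHF q_gt0 N0) N0 !(mul0r, mulr0, subrr).
by field; rewrite q_neq0 Z_neq0 N_neq0.
Unshelve. all: by end_near.
Qed.
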